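(* Let $K\ge1$, $m=2^K-1$ and $B=2^{2^K}$. Then the factor complexity of the infinite word $a_m(0)a_m(1)a_m(2)\cdots$ satisfies $p_{a_m}(n)=2n$ for all $1\le n\le B+1$.
   Context: For $n\ge0$ write $b_p(n)=\lfloor n/2^p\rfloor\bmod 2$; $\oplus$ is XOR and $\&$ is bitwise AND. For $m\ge0$, $a_m(n)=\bigoplus_{p\ge0,\ p\,\&\,m=0} b_p(n)$. For an infinite word $w$, $p_w(n)$ denotes the number of distinct factors (contiguous finite subwords) of $w$ of length $n$. *)

(* Defs.v *)
(* MathComp, with excluded middle from mathcomp.classical.boolp *)
From mathcomp Require Import all_boot boolp.

Set Implicit Arguments.
Unset Strict Implicit.
Unset Printing Implicit Defensive.

(* The bits 0 and 1 are false and true, so that XOR is addb. *)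
Definition bit (p n : nat) : bool := odd (n %/ 2 ^ p).

Lemma bitE p n : (n %/ 2 ^ p) %% 2 = bit p n.
Proof. exact: modn2. Qed.

(* The XOR over all p >= 0 with p & m = 0 has only finitely many nonzero
   terms, since bit p n = 0 for p >= n; it is therefore cut off at n.
   By xor_wordE any larger cut-off gives the same value. *)
Definition xor_word (m n : nat) : bool :=
  \big[addb/false]_(0 <= p < n | Nat.land p m == 0) bit p n.

Lemma bit_large p n : n <= p -> bit p n = false.
Proof.
move=> le_np; have lt_p2p : p < 2 ^ p by exact: ltn_expl.
by rewrite /bit (divn_small (leq_ltn_trans le_np lt_p2p)).
Qed.

Lemma xor_wordE m n N : n <= N ->
  \big[addb/false]_(0 <= p < N | Nat.land p m == 0) bit p n = xor_word m n.
Proof.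
move=> le_nN; rewrite (big_cat_nat (leq0n n) le_nN) /= [X in _ (+) X]big_nat_cond.
rewrite [X in _ (+) X]big1 ?addbF // => p /andP[/andP[le_np _] _].
exact: bit_large.
Qed.

(* An infinite word over A is a function nat -> A. *)
Definition factors (A : finType) (w : nat -> A) (n : nat) : {set n.-tuple A} :=
  [set u | `[< exists i, u = [tuple w (i + j) | j < n] >]].

Definition complexity (A : finType) (w : nat -> A) (n : nat) : nat :=
  #|factors w n|.

(* Main.v *)
(* Since m = 2^K - 1, the positions p with p & m = 0 are the multiples of 2^K,
   so a = a_m satisfies a(Bq + r) = a(q) + r mod 2 for r < B.  Hence the word is
   a concatenation of alternating blocks of even length B, and the alternation
   breaks between the blocks q and q + 1 exactly when a(q) <> a(q + 1).  A window
   of length n <= B + 1 meets at most two blocks, so it is an alternating word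
   with at most one break; conversely each of the 2n such words occurs. *)
Require Import Defs.
From mathcomp Require Import all_boot boolp.
From Stdlib Require PeanoNat.

Lemma modn_Nat_modulo m d : 0 < d -> Nat.modulo m d = m %% d.
Proof.
move=> d_gt0; have d_neq0 : d <> 0 by move=> d0; rewrite d0 in d_gt0.
have /ltP lt_d := PeanoNat.Nat.mod_upper_bound m d d_neq0.
rewrite [in RHS](PeanoNat.Nat.div_mod m d d_neq0) multE plusE mulnC.
by rewrite modnMDl modn_small.
Qed.

Lemma Nat_powE a k : Nat.pow a k = a ^ k.
Proof. by elim: k => //= k ->; rewrite expnS. Qed.

Lemma land_ones_modn p k : Nat.land p (2 ^ k - 1) = p %% 2 ^ k.
Proof.
have <- : PeanoNat.Nat.ones k = 2 ^ k - 1.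
  by rewrite PeanoNat.Nat.ones_equiv Nat_powE subn1.
by rewrite PeanoNat.Nat.land_ones Nat_powE modn_Nat_modulo ?expn_gt0.
Qed.

Lemma bit_addM p k q r : r < 2 ^ k -> bit (p + k) (2 ^ k * q + r) = bit p q.
Proof.
move=> lt_r; rewrite /bit (addnC p) expnD divnMA (mulnC _ q) divnMDl ?expn_gt0 //.
by rewrite (divn_small lt_r) addn0.
Qed.

(** Below [L = 2 ^ K] only position 0 is selected, and it gives [odd r] because [2 ^ L] is even; the
    selected positions from [L] on, shifted down by [L], read the bits of [q]. *)
Lemma xor_word_digit K q r : r < 2 ^ (2 ^ K) ->
  xor_word (2 ^ K - 1) (2 ^ (2 ^ K) * q + r) = xor_word (2 ^ K - 1) q (+) odd r.
Proof.
move=> lt_r; set L := 2 ^ K; set N := 2 ^ L * q + r.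
have L_gt0 : 0 < L by rewrite expn_gt0.
have le_qN : q <= N.
  by apply: leq_trans (leq_addr _ _); rewrite leq_pmull ?expn_gt0.
(* The cut-offs are chosen so that this shift matches the two ranges exactly. *)
rewrite -(@xor_wordE _ N (N + L)) ?leq_addr // -(@xor_wordE _ q N) //.
rewrite (big_cat_nat (leq0n L) (leq_addl N L)) /= addbC; congr (_ (+) _).
  rewrite -{1}[L]add0n big_addn addnK.
  apply: eq_big => [p|p _]; first by rewrite !land_ones_modn modnDr.
  exact: bit_addM.
rewrite big_ltn_cond // land_ones_modn mod0n eqxx big_nat_cond big1 => [|p].
  by rewrite addbF /bit divn1 oddD oddM oddX -(prednK L_gt0).
case/andP=> /andP[p_gt0 lt_pL]; rewrite land_ones_modn modn_small //.
by rewrite eqn0Ngt p_gt0.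
Qed.

(* For bk = (b, k) the break is between the letters k - 1 and k; if k = 0 there is none
   and the first letter is ~~ b. *)
Definition broken_alternation {n} (bk : bool * 'I_n) : n.-tuple bool :=
  [tuple bk.1 (+) odd j (+) (bk.2 <= j) | j < n].

Lemma broken_alternation_inj n : injective (@broken_alternation n).
Proof.
have agree (b b' : bool) (k k' : 'I_n) : k <= k' ->
    broken_alternation (b, k) = broken_alternation (b', k') ->
    (b, k) = (b', k').
  move=> le_kk' eq_u.
  have eq_at (j : 'I_n) : b (+) (k <= j) = b' (+) (k' <= j).
    move/(congr1 (fun u => tnth u j)): eq_u; rewrite !tnth_mktuple /=.
    by case: (odd j) (k <= j) (k' <= j) b b' => [] [] [] [] [].
  (* At letter [k'] both breaks have occurred, so [b = b']; letter [k] then forces [k' <= k]. *)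
  have := eq_at k'; rewrite le_kk' leqnn => /addIb eq_b.
  have := eq_at k; rewrite eq_b leqnn => /addbI/esym le_k'k.
  by congr (_, _); apply/val_inj/anti_leq; rewrite le_kk'.
move=> [b k] [b' k'] eq_u; case/orP: (leq_total k k') => le_kk'.
  exact: agree.
exact/esym/agree.
Qed.

Lemma card_broken_alternation n :
  #|[set broken_alternation bk | bk : bool * 'I_n]| = 2 * n.
Proof.
by rewrite card_imset ?card_prod ?card_bool ?card_ord //;
  exact: broken_alternation_inj.
Qed.

(** Letter [B - r] of the window opens block [q.+1]. As [B] is even, the alternation continues there
    unless the two blocks start differently; [r + j < 2 * B] excludes a third block. *)
Lemma block_window B (w : nat -> bool) q r j : ~~ odd B ->
    (forall q r, r < B -> w (B * q + r) = w q (+) odd r) ->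
    r < B -> j <= B ->
  w (B * q + r + j) =
    w q (+) odd r (+) odd j (+) ((w q != w q.+1) && (B - r <= j)).
Proof.
move=> B_even w_digit lt_rB le_jB; rewrite -addnA leq_subLR.
case: leqP => [le_B|lt_B]; last by rewrite w_digit // oddD andbF addbF addbA.
rewrite -(subnKC le_B) addnA -mulnSr w_digit; last first.
  by rewrite ltn_subLR // -addSn leq_add.
rewrite oddB // oddD (negbTE B_even) addbF.
by case: (w q) (w q.+1) (odd r) (odd j) => [] [] [] [].
Qed.

Lemma factors_digit_word B (w : nat -> bool) n :
    2 < B -> ~~ odd B -> w 0 = false ->
    (forall q r, r < B -> w (B * q + r) = w q (+) odd r) ->
    1 <= n <= B.+1 ->
  factors w n = [set broken_alternation bk | bk : bool * 'I_n].
Proof.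
move=> B_gt2 B_even w0 w_digit /andP[n_gt0 le_nB].
have B_gt0 : 0 < B by exact: ltn_trans B_gt2.
have le_jB (j : 'I_n) : j <= B by rewrite -ltnS (leq_trans (ltn_ord j)).
have w_small r : r < B -> w r = odd r.
  by move=> lt_r; rewrite -[r in LHS]add0n -(muln0 B) w_digit // w0.
have window q r (j : 'I_n) (lt_rB : r < B) :=
  block_window B w q r j B_even w_digit lt_rB (le_jB j).
apply/setP=> u; rewrite inE; apply/asboolP/imsetP => [[i ->]|[[b k] _ ->]].
  have lt_r : i %% B < B by rewrite ltn_mod.
  have i_eq : i = B * (i %/ B) + i %% B by rewrite mulnC -divn_eq.
  have [/andP[w_neq lt_n]|no_break] :=
      boolP ((w (i %/ B) != w (i %/ B).+1) && (B - i %% B < n)).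
    exists (w (i %/ B) (+) odd (i %% B), Ordinal lt_n) => //.
    by apply: eq_mktuple => j; rewrite {1}i_eq window // w_neq.
  exists (~~ (w (i %/ B) (+) odd (i %% B)), Ordinal n_gt0) => //.
  apply: eq_mktuple => j; rewrite {1}i_eq window //=.
  have -> : (w (i %/ B) != w (i %/ B).+1) && (B - i %% B <= j) = false.
    apply: contraNF no_break => /andP[-> le_j] /=.
    exact: leq_ltn_trans le_j (ltn_ord j).
  by rewrite addbF addbT addNb negbK.
have [k0|k_gt0] := posnP k.
  (* Blocks [B.-1] and [B] both start with [true], so no break separates them; offset [b] makes the
     first letter [~~ b], as [k = 0] requires. *)
  have w_pred : w B.-1 = true.
    by rewrite w_small ?prednK // -[odd _]negbK -oddS prednK.
  have w_B : w B = true.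
    by rewrite -[B in LHS]addn0 -[B in LHS]muln1 w_digit // addbF w_small // ltnW.
  exists (B * B.-1 + b); apply: eq_mktuple => j.
  have lt_b : b < B by apply: leq_ltn_trans (leq_b1 b) (ltnW B_gt2).
  rewrite window // prednK // w_pred w_B /= k0 leq0n oddb.
  by case: b (odd j) {lt_b} => [] [].
(* For 0 < k the break is the one after block q, where the bit q is chosen to
   make the first letter equal to b. *)
have lt_r : B - k < B by rewrite ltn_subrL k_gt0.
pose q : bool := b (+) odd k.
have w_q : w q = q by rewrite w_small ?oddb // (leq_ltn_trans (leq_b1 q)) // ltnW.
(* Since [q.+1 <= 2 < B], this letter is still a parity, so it differs from [w q] and the break does
   occur. *)
have w_q1 : w q.+1 = ~~ q.
  by rewrite w_small /= ?oddb // (leq_ltn_trans _ B_gt2) // ltnS leq_b1.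
exists (B * q + (B - k)); apply: eq_mktuple => j.
rewrite window // w_q w_q1 subKn // oddB // (negbTE B_even) /q /=.
by case: b (odd k) (odd j) (k <= j) {q w_q w_q1} => [] [] [] [].
Qed.

Theorem theorem41 (K m B : nat) (hK : 1 <= K) (hm : m = 2 ^ K - 1)
    (hB : B = 2 ^ (2 ^ K)) (n : nat) (hn : 1 <= n <= B + 1) :
  complexity (xor_word m) n = 2 * n.
Proof.
rewrite /complexity -card_broken_alternation (@factors_digit_word B) //.
- have le_2 : 2 <= 2 ^ K by rewrite -[X in X <= _]expn1 leq_exp2l.
  by rewrite hB (@leq_trans (2 ^ 2)) // leq_exp2l.
- by rewrite hB oddX /= orbF -lt0n expn_gt0.
- by rewrite /xor_word big_geq.
- by rewrite hm hB; exact: xor_word_digit.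
- by rewrite -(addn1 B).
Qed.
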